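(* Let $(W,S)$ be a Coxeter system and let $\underline{v}$ be a reduced expression of an element $v\in W$. Then $\tilde{\mathcal{R}}_{u,\underline{v}}(t)=\tilde{R}_{u,v}(t)$ for all $u\in W$. In particular, $\tilde{\mathcal{R}}_{u,\underline{v}}(t)$ does not depend on the choice of reduced expression $\underline{v}$ of $v$.
   Context: $\ell$ is the length function, $m_{st}$ the order of $st$. Hecke algebra: $\mathcal{H}$ is the unital $\mathbb{Z}[t,t^{-1}]$-algebra generated by $H_s$ ($s\in S$) with relations $H_s^2=1+(t^{-1}-t)H_s$ and the braid relations $H_sH_tH_s\cdots=H_tH_sH_t\cdots$ ($m_{st}$ factors each side). For $v$ with reduced expression $s_1\cdots s_k$, $H_v=H_{s_1}\cdots H_{s_k}$, $H_e=1$; these form a basis. The $R$-polynomials are defined by $(H_{v^{-1}})^{-1}=\sum_{u\in W}R_{u,v}(t)H_u$, and $\tilde{R}_{u,v}(t)\in\mathbb{N}[t]$ is the unique polynomial with $R_{u,v}(t)=\tilde{R}_{u,v}(t-t^{-1})$. Diagrammatic polynomials: An $S$-graph is a finite planar graph with boundary in the strip $\mathbb{R}\times[0,1]$, edges coloured by $S$, vertices either univalent (''dots'') or $2m_{st}$-valent with edges alternately coloured $s,t$; bottom/top sequences are the words read on $\mathbb{R}\times\{0\}$ / $\mathbb{R}\times\{1\}$; the degree is the number of dots. For a word $\underline{v}=s_1\cdots s_n$, the tree $\mathbb{T}_{\underline{v}}$ has root decorated by the empty diagram; a node of depth $k-1$ decorated by $D$ with top sequence a reduced expression $\underline{u}$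 of $u\in W$ has: if $\ell(us_k)>\ell(u)$, two children, $D$ with an $s_k$-coloured straight strand added on the right (top $\underline{u}s_k$), and $D$ with an $s_k$-coloured strand ending in a dot added on the right (top $\underline{u}$, degree $+1$); if $\ell(us_k)<\ell(u)$, one child, obtained by stacking $2m_{st}$-valent vertices on top of $D$ realizing braid moves from $\underline{u}$ to a reduced expression $\underline{u}''s_k$ and joining the rightmost top $s_k$ strand to a new $s_k$ strand from the bottom by an arc (top $\underline{u}''$, degree unchanged). The depth-$n$ diagrams are the light leaves; $\mathbb{L}_{\underline{v}}(u)$ is the set of those whose top sequence is a reduced expression of $u$ (any admissible choice of braid moves). $\tilde{\mathcal{R}}_{u,\underline{v}}(t)=\sum_{l\in\mathbb{L}_{\underline{v}}(u)}t^{\deg(l)}$, and for the empty word it is $1$ if $u=e$, $0$ otherwise. *)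

(* Defs.v *)
From HB Require Import structures.
From mathcomp Require Import all_boot all_order all_algebra.
From mathcomp Require Import fraction.
From mathcomp Require Import boolp classical_sets functions cardinality fsbigop.

Set Implicit Arguments.
Unset Strict Implicit.
Unset Printing Implicit Defensive.

Import GRing.Theory.
Local Open Scope classical_set_scope.
Local Open Scope ring_scope.

Local Notation "x %:F" := (tofrac x) : ring_scope.

(* Z[t,t^-1], as the subring { p / t^n } of the fraction field of Z[t]. *)
Definition laurent_pred : {pred {fraction {poly int}}} :=
  fun x => `[< exists (p : {poly int}) (n : nat), x = p%:F / 'X%:F ^+ n >].

Record laurent := Laurent {
  laurent_val : {fraction {poly int}};
  laurent_valP : laurent_val \in laurent_pred }.

Lemma fracX_neq0 : 'X%:F != 0 :> {fraction {poly int}}.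
Proof. by rewrite tofrac_eq0 polyX_eq0. Qed.

Lemma laurent_subring : subring_closed laurent_pred.
Proof.
split.
- by apply/asboolP; exists 1, 0%N; rewrite expr0 divr1 tofrac1.
- move=> _ _ /asboolP[p [m ->]] /asboolP[q [n ->]]; apply/asboolP.
  exists (p * 'X^n - q * 'X^m), (m + n)%N.
  have nz k : 'X%:F ^+ k != 0 :> {fraction {poly int}}.
    by rewrite expf_neq0 ?fracX_neq0.
  rewrite tofracB !tofracM !tofracXn exprD mulrBl.
  congr (_ - _); first by rewrite -mulf_div divff ?mulr1.
  by rewrite [_ ^+ m * _]mulrC -mulf_div divff ?mulr1.
- move=> _ _ /asboolP[p [m ->]] /asboolP[q [n ->]]; apply/asboolP.
  by exists (p * q), (m + n)%N; rewrite mulf_div tofracM exprD.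
Qed.

HB.instance Definition _ := [isSub for laurent_val].
HB.instance Definition _ := [Choice of laurent by <:].
HB.instance Definition _ :=
  GRing.isSubringClosed.Build _ laurent_pred laurent_subring.
HB.instance Definition _ := [SubChoice_isSubComNzRing of laurent by <:].

Lemma laurentX_subproof : 'X%:F \in laurent_pred.
Proof. by apply/asboolP; exists 'X, 0%N; rewrite expr0 divr1. Qed.

Lemma laurentXV_subproof : ('X%:F)^-1 \in laurent_pred.
Proof. by apply/asboolP; exists 1, 1%N; rewrite tofrac1 mul1r expr1. Qed.

Definition lauT : laurent := Laurent laurentX_subproof.
Definition lauTV : laurent := Laurent laurentXV_subproof.

Lemma lauT_lauTV : lauT * lauTV = 1.
Proof. by apply/val_inj; rewrite /= divff ?fracX_neq0. Qed.

(* The order of [x]; the value 0 encodes infinite order. *)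
Definition gorder (G : groupType) (x : G) : nat :=
  xget 0%N [set n | [/\ (0 < n)%N, (x ^+ n = 1)%g &
                      forall k, (0 < k < n)%N -> (x ^+ k <> 1)%g]].

Section Coxeter.
Variables (W : groupType) (S : set W).
Implicit Types (s t : S) (e : seq S) (w : W).

Definition cox_m s t : nat := gorder (\val s * \val t)%g.

Definition wprod e : W := (\prod_(s <- e) \val s)%g.

(* The pairs with [cox_m s t = 0] (infinite order) impose no relation. *)
Definition coxeter_system : Prop :=
  [/\ forall s, gorder (\val s) = 2%N,
      forall w, exists e, wprod e = w
    & forall (G : groupType) (f : S -> G),
        (forall s t, (0 < cox_m s t)%N -> ((f s * f t) ^+ cox_m s t = 1)%g) ->
        exists phi : {multiplicative W -> G}, forall s, phi (\val s) = f s].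

Definition cox_length w : nat :=
  xget 0%N [set n | (exists2 e, wprod e = w & size e = n) /\
                    forall e, wprod e = w -> (n <= size e)%N].

Definition reduced_expr e w : Prop := wprod e = w /\ size e = cox_length w.

(* [:: s; t; s; ...], with n letters. *)
Fixpoint alt_word (n : nat) s t : seq S :=
  if n is n'.+1 then s :: alt_word n' t s else [::].

Definition braid_word s t : seq S := alt_word (cox_m s t) s t.

Definition hecke_relations (B : algType laurent) (h : S -> B) : Prop :=
  (forall s, h s ^+ 2 = 1 + (lauTV - lauT) *: h s) /\
  (forall s t, s != t -> (0 < cox_m s t)%N ->
     \prod_(r <- braid_word s t) h r = \prod_(r <- braid_word t s) h r).

(* The algebra presented by the generators [h s] and the above relations. *)
Definition hecke_algebra (H : algType laurent) (h : S -> H) : Prop :=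
  hecke_relations h /\
  forall (B : algType laurent) (k : S -> B), hecke_relations k ->
    exists2 f : {lrmorphism H -> B}, forall s, f (h s) = k s
      & forall g : {lrmorphism H -> B}, (forall s, g (h s) = k s) -> f =1 g.

Section RPolynomials.
Variables (H : algType laurent) (h : S -> H).

Definition hecke_std w : H :=
  \prod_(s <- xget [::] [set e | reduced_expr e w]) h s.

(* [R_family v R] : R is finitely supported and sum_u R(u) H_u is the
   (two-sided) inverse of H_{v^-1}. *)
Definition R_family (v : W) (R : W -> laurent) : Prop :=
  let x := \sum_(u \in [set: W]) R u *: hecke_std u in
  [/\ finite_set [set u | R u != 0],
      x * hecke_std v^-1%g = 1 & hecke_std v^-1%g * x = 1].

Definition Rpoly (u v : W) : laurent := xget (fun=> 0) (R_family v) u.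

Definition Rtilde (u v : W) : {poly nat} :=
  xget 0 [set p : {poly nat} |
    Rpoly u v = (map_poly (fun n : nat => n%:R : laurent) p).[lauT - lauTV]].

End RPolynomials.

(* [sgraph b c] : S-graphs with bottom sequence b and top sequence c, as
   horizontal and vertical composites of elementary pieces: every planar graph
   of the required kind in the strip is, up to isotopy, such a composite.
   A 2m-valent vertex is drawn with m edges going down and m going up (bending
   edges with cups and caps yields the other positions). *)
Inductive sgraph : seq S -> seq S -> Type :=
| SStrands b : sgraph b b
| SEndDot s : sgraph [:: s] [::]
| SStartDot s : sgraph [::] [:: s]
| SCap s : sgraph [:: s; s] [::]
| SCup s : sgraph [::] [:: s; s]
| SVertex s t : s != t -> (0 < cox_m s t)%N ->
    sgraph (braid_word s t) (braid_word t s)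
| SBeside b c b' c' : sgraph b c -> sgraph b' c' ->
    sgraph (b ++ b') (c ++ c')
| SStack b c c' d : sgraph b c -> c = c' -> sgraph c' d -> sgraph b d.

Fixpoint sdeg b c (D : sgraph b c) : nat :=
  match D with
  | SEndDot _ | SStartDot _ => 1
  | SBeside _ _ _ _ D1 D2 => sdeg D1 + sdeg D2
  | SStack _ _ _ _ D1 _ D2 => sdeg D1 + sdeg D2
  | _ => 0
  end%N.

Record diagram := Diagram {
  dbot : seq S; dtop : seq S; dgraph : sgraph dbot dtop }.

Definition ddeg (D : diagram) : nat := sdeg (dgraph D).

(* Finite sequences of braid moves, read from the source to the target. *)
Inductive braid_moves : seq S -> seq S -> Type :=
| BMnil e : braid_moves e e
| BMcons l r s t e : s != t -> (0 < cox_m s t)%N ->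
    braid_moves (l ++ braid_word t s ++ r) e ->
    braid_moves (l ++ braid_word s t ++ r) e.

Fixpoint stack_moves b e e' (B : braid_moves e e') : sgraph b e -> sgraph b e' :=
  match B in braid_moves e1 e2 return sgraph b e1 -> sgraph b e2 with
  | BMnil _ => id
  | BMcons l r _ _ _ st m_gt0 B' => fun D =>
      stack_moves B' (SStack D erefl
        (SBeside (SStrands l) (SBeside (SVertex st m_gt0) (SStrands r))))
  end.

Definition add_strand b e (D : sgraph b e) s : sgraph (b ++ [:: s]) (e ++ [:: s]) :=
  SBeside D (SStrands [:: s]).

Definition add_dot b e (D : sgraph b e) s : sgraph (b ++ [:: s]) (e ++ [::]) :=
  SBeside D (SEndDot s).

Definition add_arc b e s (D : sgraph b (e ++ [:: s])) :
    sgraph (b ++ [:: s]) (e ++ [::]) :=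
  SStack (add_strand D s) (esym (catA e [:: s] [:: s]))
    (SBeside (SStrands e) (SCap s)).

(* [lltree D w] : the possible subtrees below a node decorated by D when the
   letters w remain to be read; its inhabitants differ by the braid moves chosen
   at the unary nodes. *)
Inductive lltree : forall b e, sgraph b e -> seq S -> Type :=
| LLleaf b e (D : sgraph b e) : lltree D [::]
| LLup b e (D : sgraph b e) s (w : seq S) :
    (cox_length (wprod e) < cox_length (wprod e * \val s)%g)%N ->
    lltree (add_strand D s) w -> lltree (add_dot D s) w -> lltree D (s :: w)
| LLdown b e (D : sgraph b e) s (w : seq S) e'' (B : braid_moves e (e'' ++ [:: s])) :
    (cox_length (wprod e * \val s)%g < cox_length (wprod e))%N ->
    lltree (add_arc (stack_moves B D)) w -> lltree D (s :: w).

Definition light_leaves_tree (w : seq S) : Type := lltree (SStrands [::]) w.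

(* Distinct leaves carry non-isotopic diagrams (the bottom edges ending at once
   in a dot differ), so the list of leaves lists a set. *)
Fixpoint light_leaves b e (D : sgraph b e) (w : seq S) (T : lltree D w) : seq diagram :=
  match T with
  | LLleaf _ _ D => [:: Diagram D]
  | LLup _ _ _ _ _ _ T1 T2 => light_leaves T1 ++ light_leaves T2
  | LLdown _ _ _ _ _ _ _ _ T' => light_leaves T'
  end.

Definition diag_Rtilde (u : W) (w : seq S) (T : light_leaves_tree w) : {poly nat} :=
  \sum_(l <- light_leaves T | `[< reduced_expr (dtop l) u >]) 'X^(ddeg l).

End Coxeter.

(* Main.v *)
(* The inverse of H_(v^-1) is the product of the H_s + (t - t^-1) over the letters
   of a reduced word of v. Expanding it from left to right reproduces the tree:
   H_u (H_s + z) is H_(us) + z H_u if us > u and H_(us) if us < u, which are the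
   binary and unary nodes, a dot counting for a factor z = t - t^-1. As the H_u
   are linearly independent and z is transcendental over Z, the coefficients of
   this expansion determine both R_(u,v) and its representation as a polynomial
   in z.

   Matsumoto's theorem and the exchange condition come from the reflection
   cocycle, which the presentation of W provides. Independence of the H_u comes
   from the right regular representation, made to act on all functions
   W -> Z[t,t^-1], i.e. on functionals; its braid relations hold because it
   commutes with the left one. *)

Require Import Defs.
From HB Require Import structures.
From mathcomp Require Import all_boot all_order all_algebra.
From mathcomp Require Import fraction ring zify.
From mathcomp Require Import boolp classical_sets functions cardinality fsbigop.

Set Implicit Arguments.
Unset Strict Implicit.
Unset Printing Implicit Defensive.

Import GRing.Theory.
Local Open Scope classical_set_scope.

(** * Orders of group elements *)

Section Order.
Variable G : groupType.
Implicit Type x : G.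
Local Open Scope group_scope.

Lemma expg_gorder x : (0 < gorder x)%N -> x ^+ gorder x = 1.
Proof. by rewrite /gorder; case: xgetP => // n _ []. Qed.

Lemma gorder_min x k : (0 < k < gorder x)%N -> x ^+ k <> 1.
Proof.
rewrite /gorder; case: xgetP => [n _ [_ _ nmin] /nmin//|_].
by rewrite ltn0 andbF.
Qed.

Lemma gorder_gt0 x k : (0 < k)%N -> x ^+ k = 1 -> (0 < gorder x <= k)%N.
Proof.
move=> k0 xk; have ex : exists k, (0 < k)%N && (x ^+ k == 1).
  by exists k; rewrite k0 xk eqxx.
have o0 : (0 < gorder x)%N.
  rewrite /gorder; case: xgetP => [n _ []//|/(_ (ex_minn ex))[]].
  case: ex_minnP => n /andP[n0 /eqP xn] nmin; split=> // j /andP[j0 jn] xj.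
  by have := nmin j; rewrite j0 xj eqxx leqNgt jn => /(_ isT).
rewrite o0 leqNgt; apply/negP => ko.
by case: (@gorder_min x k); rewrite ?k0 ?ko.
Qed.

Lemma gorder_inv x : gorder x^-1 = gorder x.
Proof.
have gt0 (y : G) : (0 < gorder y)%N -> (0 < gorder y^-1 <= gorder y)%N.
  by move=> y0; apply: gorder_gt0 => //; rewrite expVgn expg_gorder ?invg1.
have := gt0 x; have := gt0 x^-1; rewrite invgK.
case: (gorder x) (gorder x^-1) => [|m] [|n] // => [/(_ isT)//|_ /(_ isT)//|].
move=> /(_ isT)/andP[_ le1] /(_ isT)/andP[_ le2].
by apply/eqP; rewrite eqn_leq le1 le2.
Qed.

End Order.

(** * The reflection cocycle *)

Section ReflectionCocycle.
Variable W : groupType.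
Local Open Scope group_scope.

(* The semidirect product of W with the functions W -> Z/2, on which W acts by
   conjugation of the argument: a morphism from W into it that lifts the
   identity is a cocycle of W with values in these functions. *)
Definition cocycle_group : Type := W * (W -> bool).
HB.instance Definition _ := Choice.on cocycle_group.

Definition cocycle_mul (a b : cocycle_group) : cocycle_group :=
  (a.1 * b.1, fun x => a.2 x (+) b.2 (x ^ a.1)).
Definition cocycle_one : cocycle_group := (1, fun=> false).
Definition cocycle_inv (a : cocycle_group) : cocycle_group :=
  (a.1^-1, fun x => a.2 (x ^ a.1^-1)).

Lemma cocycle_mulA : associative cocycle_mul.
Proof.
move=> a b c; congr (_, _); first exact: mulgA.
by apply/funext => x /=; rewrite conjgM addbA.
Qed.

Lemma cocycle_mul1g : left_id cocycle_one cocycle_mul.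
Proof.
move=> [a f]; congr (_, _); first exact: mul1g.
by apply/funext => x /=; rewrite conjg1.
Qed.

Lemma cocycle_mulg1 : right_id cocycle_one cocycle_mul.
Proof.
move=> [a f]; congr (_, _); first exact: mulg1.
by apply/funext => x /=; rewrite addbF.
Qed.

Lemma cocycle_mulVg : left_inverse cocycle_one cocycle_inv cocycle_mul.
Proof.
move=> [a f]; congr (_, _); first exact: mulVg.
by apply/funext => x /=; rewrite addbb.
Qed.

Lemma cocycle_mulgV : right_inverse cocycle_one cocycle_inv cocycle_mul.
Proof.
move=> [a f]; congr (_, _); first exact: mulgV.
by apply/funext => x /=; rewrite conjgK addbb.
Qed.

HB.instance Definition _ := isGroup.Build cocycle_group cocycle_mulA
  cocycle_mul1g cocycle_mulg1 cocycle_mulVg cocycle_mulgV.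

Lemma cocycle_group_mulE (a b : cocycle_group) :
  a * b = (a.1 * b.1, fun x => a.2 x (+) b.2 (x ^ a.1)).
Proof. by []. Qed.

End ReflectionCocycle.

(** * Words and length *)

Section Words.
Variables (W : groupType) (S : set W).
Implicit Types (s t : S) (e l r : seq S) (w x : W).
Local Open Scope group_scope.

Lemma wprod_nil : wprod (Nil S) = 1.
Proof. exact: big_nil. Qed.

Lemma wprod_cons s e : wprod (s :: e) = \val s * wprod e.
Proof. exact: big_cons. Qed.

Lemma wprod_cat l r : wprod (l ++ r) = wprod l * wprod r.
Proof. exact: big_cat. Qed.

Lemma wprod_seq1 s : wprod [:: s] = \val s.
Proof. exact: big_seq1. Qed.

Definition wprodE := (wprod_nil, wprod_cons, wprod_cat).

(* The reflections s_1 .. s_(i-1) s_i s_(i-1)^-1 .. s_1^-1 of a word s_1 .. s_n. *)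
Fixpoint reflections e : seq W :=
  if e is s :: e' then \val s :: [seq x ^ (\val s)^-1 | x <- reflections e']
  else [::].

Lemma size_reflections e : size (reflections e) = size e.
Proof. by elim: e => //= s e IHe; rewrite size_map IHe. Qed.

(** Modulo 2 this recursion is left multiplication by the lift of [s] in [cocycle_group]. *)
Lemma count_mem_reflections x s e : count_mem x (reflections (s :: e)) =
  ((x == \val s) + count_mem (x ^ \val s)%g (reflections e))%N.
Proof.
rewrite /= eq_sym count_map; congr (_ + _)%N.
set g : W := \val s; apply: eq_count => y /=.
by rewrite -(inj_eq (@conjg_inj _ g)) conjgKV.
Qed.

Lemma reflections_rcons e s :
  reflections (rcons e s) = rcons (reflections e) (\val s ^ (wprod e)^-1).
Proof.
elim: e => [|t e IHe] /=; first by rewrite wprod_nil invg1 conjg1.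
by rewrite IHe map_rcons wprod_cons invgM conjgM.
Qed.

Lemma reflections_cat l r : reflections (l ++ r) =
  reflections l ++ [seq x ^ (wprod l)^-1 | x <- reflections r].
Proof.
elim: l => [|s l IHl] /=.
  by rewrite wprod_nil invg1 map_id_in // => x _; rewrite conjg1.
rewrite IHl map_cat -map_comp wprod_cons; congr (_ :: _ ++ _).
by apply: eq_map => x /=; rewrite invgM conjgM.
Qed.

Lemma mem_reflectionsP x e : x \in reflections e ->
  exists l r s, e = l ++ s :: r /\ x = \val s ^ (wprod l)^-1.
Proof.
elim: e x => //= s e IHe x; rewrite inE => /predU1P[->|/mapP[y /IHe]].
  by exists [::], e, s; rewrite wprod_nil invg1 conjg1.
move=> [l [r [t [-> ->]]]] ->; exists (s :: l), r, t.
by rewrite wprod_cons invgM conjgM.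
Qed.

Lemma cox_length_leq e : (cox_length S (wprod e) <= size e)%N.
Proof.
rewrite /cox_length; case: xgetP => [n _ [_ nmin]|_//].
exact: nmin.
Qed.

Lemma cox_length1 : cox_length S 1 = 0%N.
Proof. by apply/eqP; rewrite -leqn0 -wprod_nil cox_length_leq. Qed.

Lemma reduced_nil : reduced_expr (Nil S) 1.
Proof. by split; rewrite ?wprod_nil ?cox_length1. Qed.

Hypothesis WS : coxeter_system S.

Lemma reduced_exists w : exists e, reduced_expr e w.
Proof.
have [_ /(_ w)[e0 we0] _] := WS.
have ex : exists n, `[< exists2 e : seq S, wprod e = w & size e = n >].
  by exists (size e0); apply/asboolP; exists e0.
pose n := ex_minn ex; have : cox_length S w = n.
  apply: xget_unique; rewrite /n.
    case: ex_minnP => m /asboolP mP mmin; split=> // e we.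
    by apply: mmin; apply/asboolP; exists e.
  move=> m [[e we <-] emin]; case: ex_minnP => k /asboolP[e' we' <-] kmin.
  apply/eqP; rewrite eqn_leq emin // kmin //; apply/asboolP; by exists e.
rewrite /n; case: ex_minnP => m /asboolP[e we <-] _ lw.
by exists e.
Qed.

Lemma gen_mulgg s : \val s * \val s = 1.
Proof.
have [/(_ s) o2 _ _] := WS; rewrite -expg2 -o2 expg_gorder//.
by rewrite o2.
Qed.

Lemma gen_inv s : (\val s)^-1 = \val s.
Proof. exact/mulg1_eq/gen_mulgg. Qed.

Lemma gen_conj s : \val s ^ \val s = \val s.
Proof. by rewrite conjgE gen_mulgg mulg1 gen_inv. Qed.

Lemma gen_mulK s w : \val s * (\val s * w) = w.
Proof. by rewrite mulgA gen_mulgg mul1g. Qed.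

Lemma gen_mulgK s w : w * \val s * \val s = w.
Proof. by rewrite -mulgA gen_mulgg mulg1. Qed.

Lemma wprod_rev e : wprod (rev e) = (wprod e)^-1.
Proof.
elim: e => [|s e IHe]; first by rewrite wprod_nil invg1.
by rewrite rev_cons -cats1 wprod_cat wprod_seq1 wprod_cons invgM IHe gen_inv.
Qed.

Lemma cox_length_inv w : cox_length S w^-1 = cox_length S w.
Proof.
have le x : (cox_length S x^-1 <= cox_length S x)%N.
  have [e [<- <-]] := reduced_exists x.
  by rewrite -wprod_rev -(size_rev e) cox_length_leq.
by apply/eqP; rewrite eqn_leq le -{1}[w]invgK le.
Qed.

Lemma cox_length_mull s w :
  (cox_length S (\val s * w) <= (cox_length S w).+1)%N.
Proof.
have [e [<- <-]] := reduced_exists w.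
by rewrite -wprod_cons cox_length_leq.
Qed.

Lemma expg_gen_swap s t k :
  (\val s * \val t) ^+ k * \val s = \val s * (\val t * \val s) ^+ k.
Proof.
elim: k => [|k IHk]; first by rewrite !expg0 mul1g mulg1.
by rewrite expgS -mulgA IHk expgS !mulgA.
Qed.

Lemma conjgX_gen s t k :
  \val s ^ ((\val s * \val t) ^+ k)^-1 = (\val s * \val t) ^+ k.*2 * \val s.
Proof.
rewrite conjgE invgK -expVgn invgM !gen_inv -expg_gen_swap.
by rewrite mulgA -expgnDr addnn.
Qed.

(** * Parity of the number of occurrences of a reflection *)

Definition cocycle_gen s : cocycle_group W := (\val s, fun x => x == \val s).

(** The listed elements are the reflections of the alternating word s, t, s, ... with 2k letters;
    each new factor appends two of them. *)
Lemma cocycle_genM s t k : (cocycle_gen s * cocycle_gen t) ^+ k =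
  ((\val s * \val t) ^+ k, fun x =>
     odd (count_mem x [seq (\val s * \val t) ^+ i * \val s | i <- iota 0 k.*2]))
  :> cocycle_group W.
Proof.
elim: k => [|k IHk]; first by [].
rewrite expgSr IHk !cocycle_group_mulE; congr (_, _); first by rewrite expgSr.
apply/funext => x; rewrite doubleS -addn2 iotaD map_cat count_cat oddD add0n.
set st := \val s * \val t.
have odd2 (y z : W) : odd (count_mem x [:: y; z]) = (y == x) (+) (z == x).
  by rewrite /= addn0 oddD !oddb.
rewrite [map _ (iota k.*2 2)]/= odd2.
congr (_ (+) _); change ((x ^ st ^+ k == \val s) (+)
  ((x ^ st ^+ k) ^ \val s == \val t) =
  (st ^+ k.*2 * \val s == x) (+) (st ^+ k.*2.+1 * \val s == x)).
have moveE (y z g : W) : (y ^ g == z) = (z ^ g^-1 == y).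
  by rewrite -(inj_eq (@conjg_inj _ g^-1)) conjgK eq_sym.
rewrite -conjgM [_ == \val s]moveE [_ == \val t]moveE conjgX_gen.
congr (_ (+) (_ == x)); rewrite invgM conjgM.
rewrite [_ ^ (\val s)^-1]conjgE invgK gen_inv mulgA conjMg conjgX_gen.
rewrite -/st conjgE invgK [X in X * _ = _]mulgA -expgSr expgS mulgK mulgA.
by rewrite -expgS.
Qed.

(** As (st)^m = 1, the last m of the 2m reflections repeat the first m, so every count is even. The
    lifts thus satisfy the relations of the presentation. *)
Lemma cocycle_genX s t : (0 < cox_m s t)%N ->
  (cocycle_gen s * cocycle_gen t) ^+ cox_m s t = 1.
Proof.
move=> m0; have m1 : (\val s * \val t) ^+ cox_m s t = 1 := expg_gorder m0; rewrite cocycle_genM.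
congr (_, _); first exact: m1.
apply/funext => x; rewrite -addnn iotaD add0n map_cat count_cat.
have -> n : iota n n = [seq (n + i)%N | i <- iota 0 n] by rewrite -iotaDl addn0.
rewrite -map_comp.
rewrite (eq_map (g := fun i => (\val s * \val t) ^+ i * \val s)); last first.
  move=> i; rewrite -[LHS]/((\val s * \val t) ^+ (cox_m s t + i) * \val s).
  by rewrite expgnDr m1 mul1g.
by rewrite addnn odd_double.
Qed.

(** The presentation of [W] extends [cocycle_gen] to a morphism, whose second component computes the
    parity on each word; the parity therefore depends only on the product of the word. *)
Lemma reflection_cocycle : exists N : W -> W -> bool,
  forall e x, N (wprod e) x = odd (count_mem x (reflections e)).
Proof.
have [_ _ /(_ _ _ cocycle_genX)[phi phiE]] := WS.
exists (fun w => (phi w).2).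
suff phiP e : phi (wprod e) =
    (wprod e, fun x => odd (count_mem x (reflections e))) :> cocycle_group W.
  by move=> e x; rewrite phiP.
elim: e => [|s e IHe].
  have phi1 : phi 1 = 1 by apply: (mulgI (phi 1)); rewrite -gmulfM !mulg1.
  by rewrite wprod_nil phi1.
rewrite wprod_cons gmulfM IHe phiE cocycle_group_mulE; congr (_, _).
by apply/funext => x; rewrite count_mem_reflections oddD oddb.
Qed.

Lemma odd_count_reflections e e' x : wprod e = wprod e' ->
  odd (count_mem x (reflections e)) = odd (count_mem x (reflections e')).
Proof. by have [N NE] := reflection_cocycle; rewrite -!NE => ->. Qed.

(** A reflection listed once has odd count, so it occurs in every word for the same element; a
    shortest such word then has at least as many letters. *)
Lemma uniq_reflections_reduced e :
  uniq (reflections e) -> reduced_expr e (wprod e).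
Proof.
move=> ue; split=> //; apply/eqP; rewrite eqn_leq cox_length_leq andbT.
have [e' [we' <-]] := reduced_exists (wprod e).
rewrite -!size_reflections; apply: uniq_leq_size => // x xe.
rewrite -has_pred1 has_count lt0n; apply: contraTneq isT => e'0.
by have := odd_count_reflections x we'; rewrite e'0 count_uniq_mem// xe.
Qed.

(** * Descents and the exchange condition *)

Definition ldescent s w := (cox_length S (\val s * w)%g < cox_length S w)%N.
Definition rdescent w s := (cox_length S (w * \val s)%g < cox_length S w)%N.

Lemma reflection_del l s r :
  \val s ^ (wprod l)^-1 * wprod (l ++ s :: r) = wprod (l ++ r).
Proof. by rewrite !wprodE conjgE invgK !mulgA mulgVK gen_mulgK. Qed.

(** An odd count forces [\val s] to be a reflection of a reduced word, and multiplying by it deletes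
    a letter. *)
Lemma ldescentE s e :
  ldescent s (wprod e) = odd (count_mem (\val s) (reflections e)).
Proof.
have odd_desc e' : odd (count_mem (\val s) (reflections e')) ->
    ldescent s (wprod e').
  have [e1 [we1 le1]] := reduced_exists (wprod e').
  rewrite -(odd_count_reflections _ we1) => o1.
  have /mem_reflectionsP[l [r [t [e1E sE]]]] : \val s \in reflections e1.
    by rewrite -has_pred1 has_count lt0n; apply: contraTneq o1 => ->.
  rewrite /ldescent -le1 -we1 {1}e1E {1}sE reflection_del e1E.
  by rewrite (leq_ltn_trans (cox_length_leq _))// !size_cat addnS.
(* If the count is even, prepending s makes it odd, so s is a descent of sw: then w is shorter than
   sw. *)
apply/idP/idP => [desc|/odd_desc//]; apply: contraTT desc => even.
have /odd_desc : odd (count_mem (\val s) (reflections (s :: e))).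
  by rewrite count_mem_reflections eqxx oddD gen_conj oddb addTb.
by rewrite /ldescent wprod_cons gen_mulK -leqNgt => /ltnW.
Qed.

Lemma ldescent_mem s e : ldescent s (wprod e) -> \val s \in reflections e.
Proof.
rewrite ldescentE => o1.
by rewrite -has_pred1 has_count lt0n; apply: contraTneq o1 => ->.
Qed.

(** Appending s to a word of w adds the single reflection w s w^-1, which is t exactly when tw =
    ws. *)
Lemma ldescent_mulr t w s :
  ldescent t (w * \val s) = ldescent t w (+) (\val t * w == w * \val s).
Proof.
have [e [<- _]] := reduced_exists w.
rewrite -[wprod e * _](_ : wprod (rcons e s) = _); last first.
  by rewrite -cats1 wprod_cat wprod_seq1.
rewrite !ldescentE reflections_rcons -cats1 count_cat oddD /= addn0 oddb.
congr (_ (+) _); rewrite conjgE invgK mulgA eq_sym.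
by rewrite -(inj_eq (@mulIg _ (wprod e))) mulgVK -cats1 wprod_cat wprod_seq1.
Qed.

Lemma rdescentE w s : rdescent w s = ldescent s w^-1.
Proof.
by rewrite /rdescent /ldescent -cox_length_inv invgM gen_inv cox_length_inv.
Qed.

Lemma ldescent_mull s w : ldescent s (\val s * w) = ~~ ldescent s w.
Proof.
have [e [<- _]] := reduced_exists w; rewrite -wprod_cons !ldescentE.
by rewrite count_mem_reflections eqxx oddD gen_conj.
Qed.

Lemma cox_length_ldescent s w :
  ldescent s w -> cox_length S w = (cox_length S (\val s * w)).+1.
Proof.
move=> d; apply/eqP; rewrite eqn_leq [X in _ && X]d andbT.
by rewrite -{1}(gen_mulK s w) cox_length_mull.
Qed.

Lemma rdescent_mulr w s : rdescent (w * \val s) s = ~~ rdescent w s.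
Proof. by rewrite !rdescentE invgM gen_inv ldescent_mull. Qed.

Lemma cox_length_rdescent w s :
  rdescent w s -> cox_length S w = (cox_length S (w * \val s)).+1.
Proof.
rewrite rdescentE => /cox_length_ldescent.
by rewrite -{1}(gen_inv s) -invgM !cox_length_inv.
Qed.

Lemma cox_length_rdescentN w s :
  ~~ rdescent w s -> cox_length S (w * \val s) = (cox_length S w).+1.
Proof. by rewrite -rdescent_mulr => /cox_length_rdescent; rewrite gen_mulgK. Qed.

Lemma rdescent_mull w t s :
  rdescent (\val t * w) s = rdescent w s (+) (\val t * w == w * \val s).
Proof.
rewrite !rdescentE invgM gen_inv ldescent_mulr; congr (_ (+) _).
by rewrite -(inj_eq (@invg_inj _)) !invgM !invgK !gen_inv eq_sym.
Qed.

End Words.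

(** * Braid moves and Matsumoto's theorem *)

Section Matsumoto.
Variables (W : groupType) (S : set W).
Hypothesis WS : coxeter_system S.
Implicit Types (s t : S) (e l r : seq S) (w x : W).
Local Open Scope group_scope.

Lemma size_alt_word k s t : size (alt_word k s t) = k.
Proof. by elim: k s t => //= k IHk s t; rewrite IHk. Qed.

Lemma reflections_alt_word k s t : reflections (alt_word k s t) =
  [seq (\val s * \val t) ^+ i * \val s | i <- iota 0 k].
Proof.
elim: k s t => // k IHk s t; rewrite [LHS]/= IHk -map_comp.
rewrite [RHS]/= expg0 mul1g (iotaDl 1 0 k) -map_comp; congr (_ :: _).
have E i : ((\val t * \val s) ^+ i * \val t) ^ (\val s)^-1 =
    (\val s * \val t) ^+ i.+1 * \val s.
  by rewrite conjgE invgK gen_inv// !mulgA -expg_gen_swap// expgSr !mulgA.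
by apply: eq_map => i; exact: E.
Qed.

(** When k is the order of st, the power is 1 and this is the braid relation in [W]. *)
Lemma wprod_alt_word_swap k s t :
  wprod (alt_word k s t) = (\val s * \val t) ^+ k * wprod (alt_word k t s).
Proof.
elim: k s t => [|k IHk] s t; first by rewrite expg0 mul1g.
rewrite /= !wprod_cons IHk mulgA -expg_gen_swap// expgSr -!mulgA; congr (_ * _).
by rewrite (gen_mulK WS).
Qed.

Lemma cox_mC s t : cox_m s t = cox_m t s.
Proof. by rewrite /cox_m -gorder_inv invgM !gen_inv. Qed.

Lemma wprod_braid_word s t : (0 < cox_m s t)%N ->
  wprod (braid_word s t) = wprod (braid_word t s).
Proof.
move=> m0; rewrite /braid_word cox_mC wprod_alt_word_swap -cox_mC.
by rewrite expg_gorder ?mul1g.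
Qed.

Lemma expg_gen_neq s t i j : (i < j)%N -> (j < cox_m s t)%N ->
  (\val s * \val t) ^+ i <> (\val s * \val t) ^+ j.
Proof.
move=> ij jm /esym ijE; apply: (@gorder_min _ (\val s * \val t) (j - i)%N).
  by rewrite subn_gt0 ij (leq_ltn_trans (leq_subr _ _)).
by rewrite expgnFr 1?ltnW// ijE mulgV.
Qed.

(** Its reflections (st)^i s, with i below the order of st, are distinct. *)
Lemma braid_word_reduced s t : reduced_expr (braid_word s t) (wprod (braid_word s t)).
Proof.
apply: (uniq_reflections_reduced WS); rewrite reflections_alt_word.
rewrite map_inj_in_uniq ?iota_uniq// => i j.
rewrite !mem_iota /= !add0n => im jm /mulIg ijE.
by case: (ltngtP i j) => // ij; case: (@expg_gen_neq s t _ _ ij).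
Qed.

Definition braid_equiv e e' := inhabited (braid_moves e e').

Lemma braid_equiv_refl e : braid_equiv e e.
Proof. exact/inhabits/BMnil. Qed.

Lemma braid_equiv_trans e2 e1 e3 :
  braid_equiv e1 e2 -> braid_equiv e2 e3 -> braid_equiv e1 e3.
Proof.
move=> [B]; elim: {e1 e2} B e3 => // l r s t e st m0 _ IH e3 /IH[B].
exact/inhabits/BMcons.
Qed.

Lemma braid_equiv_cons s e e' : braid_equiv e e' -> braid_equiv (s :: e) (s :: e').
Proof.
move=> [B]; elim: {e e'} B => [e|l r t t' e tt' m0 _ [B]].
  exact: braid_equiv_refl.
by constructor; apply: (@BMcons _ _ (s :: l)).
Qed.

Lemma braid_equiv_braid s t r : s != t -> (0 < cox_m s t)%N ->
  braid_equiv (braid_word s t ++ r) (braid_word t s ++ r).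
Proof.
move=> st m0; constructor; apply: (@BMcons _ _ [::]) => //; exact: BMnil.
Qed.

Lemma wprod_braid_equiv e e' : braid_equiv e e' -> wprod e = wprod e'.
Proof.
move=> [B]; elim: B => // l r s t e1 _ m0 _ <-.
by rewrite !wprod_cat wprod_braid_word.
Qed.

Lemma size_braid_equiv e e' : braid_equiv e e' -> size e = size e'.
Proof.
move=> [B]; elim: B => // l r s t e1 _ m0 _ <-.
by rewrite !size_cat /braid_word !size_alt_word cox_mC.
Qed.

Lemma reduced_braid_equiv e e' w :
  braid_equiv e e' -> reduced_expr e w -> reduced_expr e' w.
Proof.
move=> be [we le].
by split; [rewrite -we (wprod_braid_equiv be)|rewrite -le (size_braid_equiv be)].
Qed.

Lemma reduced_consK s e w : reduced_expr (s :: e) w ->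
  reduced_expr e (\val s * w) /\ ldescent s w.
Proof.
move=> [<- /= se]; rewrite wprod_cons (gen_mulK WS).
have sl : (cox_length S (wprod e) <= size e)%N by exact: cox_length_leq.
rewrite /ldescent (gen_mulK WS) -wprod_cons -se ltnS sl; split=> //; split=> //.
apply/eqP; rewrite eqn_leq sl andbT -ltnS se wprod_cons.
exact: cox_length_mull.
Qed.

(* The exchange condition for s deletes a letter of the word; as long as k is
   less than the order of st, that letter cannot lie in the alternating prefix. *)
Lemma alt_word_prefix s t w k : ldescent s w -> ldescent t w -> s != t ->
  (cox_m s t = 0 \/ k <= cox_m s t)%N ->
  exists r, reduced_expr (alt_word k s t ++ r) w.
Proof.
elim: k s t => [|k IHk] s t ds dt st km.
  by have [e ew] := reduced_exists WS w; exists e.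
have kmS : (cox_m t s = 0 \/ k < cox_m t s)%N by rewrite cox_mC.
have ts : t != s by rewrite eq_sym.
have kmW : (cox_m t s = 0 \/ k <= cox_m t s)%N.
  by case: kmS => [|/ltnW]; [left|right].
(* The word given by induction starts with t; as s is a left descent too, s can be put in front at
   the cost of one letter. *)
have [r [rw rl]] := IHk t s dt ds ts kmW.
have : \val s \in reflections (alt_word k t s ++ r).
  apply: (ldescent_mem WS); first by rewrite rw.
rewrite reflections_cat mem_cat => /orP[|/mapP[x /mem_reflectionsP]]; last first.
  move=> [l [r' [u [rE ->]]]]; rewrite -conjgM -invgM -wprod_cat => sE.
  exists (l ++ r'); split; last by rewrite -rl rE /= !size_cat !addnS.
  rewrite /= wprod_cons catA -(reflection_del WS _ u r') -sE -catA -rE rw.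
  by rewrite gen_mulK.
(* A deleted letter in the prefix would give s = (ts)^i t with i < k, hence (ts)^(i+1) = 1, too
   small a power. *)
rewrite reflections_alt_word => /mapP[i]; rewrite mem_iota add0n /= => ik sE'.
have stX : (\val t * \val s) ^+ i.+1 = 1.
  by rewrite expgSr mulgA -sE' gen_mulgg.
case: kmS => km'.
  by have := @gorder_gt0 _ _ i.+1 isT stX; rewrite -/(cox_m t s) km'.
case: (@gorder_min _ (\val t * \val s) i.+1) => //=.
exact: leq_ltn_trans ik km'.
Qed.

(** For infinite order, [alt_word_prefix] would give a reduced word of w with an alternating prefix
    longer than w. *)
Lemma cox_m_gt0 s t w :
  ldescent s w -> ldescent t w -> s != t -> (0 < cox_m s t)%N.
Proof.
move=> ds dt st; rewrite lt0n; apply/eqP => m0.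
have [|r [_]] := alt_word_prefix (k := (cox_length S w).+1) ds dt st; first by left.
by move/eqP; rewrite size_cat size_alt_word gtn_eqF// ltnS leq_addr.
Qed.

(** Induction on length; a common first letter is removed. If the first letters s and t differ, both
    are descents, so w has reduced words starting with the two braid words of s and t, one move
    apart; induction links each to the given word with the same first letter. *)
Theorem matsumoto e e' w :
  reduced_expr e w -> reduced_expr e' w -> braid_equiv e e'.
Proof.
have [n ln] := ubnP (size e); elim: n => // n IHn in e e' w ln *.
case: e ln => [_ [we0 l0]|s e ln] => [[]|re].
  rewrite -l0 => _; case: e' => // _; exact: braid_equiv_refl.
case: e' => [[_ /= l0]|t e' re']; first by case: re => _; rewrite -l0.
have [re1 ds] := reduced_consK re; have [re1' dt] := reduced_consK re'.
have [st|st] := eqVneq s t.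
  by rewrite -st in re1' *; apply/braid_equiv_cons/(IHn _ _ _ ln re1 re1').
have m0 := cox_m_gt0 ds dt st.
have [|r bst] := alt_word_prefix (k := cox_m s t) ds dt st; first by right.
have stb := braid_equiv_braid r st m0.
have bts := reduced_braid_equiv stb bst.
have le (u : S) f f' : reduced_expr (u :: f) w -> reduced_expr (u :: f') w ->
    (size f < n)%N -> braid_equiv (u :: f) (u :: f').
  move=> /reduced_consK[rf _] /reduced_consK[rf' _] fn.
  exact/braid_equiv_cons/(IHn _ _ _ fn rf rf').
have szE (f f' : seq S) : reduced_expr f w -> reduced_expr f' w -> size f = size f'.
  by move=> [_ ->] [_ ->].
apply: (braid_equiv_trans (e2 := braid_word s t ++ r)).
  move: bst; rewrite /braid_word; case: (cox_m s t) m0 => // m _ bst.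
  exact: le.
apply: (braid_equiv_trans stb).
move: bts; rewrite /braid_word cox_mC; case: (cox_m s t) m0 => // m _ bts.
apply: le => //; rewrite -ltnS.
by rewrite -[(size _).+1]/(size (alt_word m.+1 t s ++ r)) (szE _ _ bts re).
Qed.

Lemma reduced_rcons e w s : reduced_expr e w -> ~~ rdescent w s ->
  reduced_expr (e ++ [:: s]) (w * \val s).
Proof.
move=> [we le] ds; split; first by rewrite wprod_cat we wprod_seq1.
by rewrite cox_length_rdescentN// size_cat le addn1.
Qed.

(** Supplies the braid moves required at a unary node of the tree. *)
Lemma rdescent_braid_equiv e w s : reduced_expr e w -> rdescent w s ->
  exists2 e'', reduced_expr e'' (w * \val s) & braid_equiv e (e'' ++ [:: s]).
Proof.
move=> re ds; have [e'' re''] := reduced_exists WS (w * \val s).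
exists e'' => //; apply: (matsumoto re).
have := reduced_rcons (s := s) re''.
by rewrite rdescent_mulr// negbK gen_mulgK//; apply.
Qed.

End Matsumoto.

(** * Linear endomorphisms of a space of functions *)

Section FunctionEndomorphisms.
Variables (R : comNzRingType) (W : groupType).
Local Open Scope ring_scope.

(** These operators form the algebra to which the universal property of the Hecke algebra is
    applied. *)
Record fun_endo := FunEndo {
  endo_fun :> (W -> R) -> W -> R;
  endo_linear : forall a f g w,
    endo_fun (fun x => a * f x + g x) w = a * endo_fun f w + endo_fun g w }.

HB.instance Definition _ := gen_eqMixin fun_endo.
HB.instance Definition _ := gen_choiceMixin fun_endo.

Lemma fun_endoP (X Y : fun_endo) : (forall f w, X f w = Y f w) -> X = Y.
Proof.
case: X Y => [X Xlin] [Y Ylin] /= XY.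
have E : X = Y by apply/funext => f; apply/funext => w.
by rewrite E in Xlin *; congr FunEndo; exact: Prop_irrelevance.
Qed.

Lemma endoD (X : fun_endo) f g w : X (fun x => f x + g x) w = X f w + X g w.
Proof.
rewrite -[X f w]mul1r -endo_linear; congr (X _ w).
by apply/funext => x; rewrite mul1r.
Qed.

Lemma endo0 (X : fun_endo) w : X (fun=> 0) w = 0.
Proof.
by apply: (addrI (X (fun=> 0) w)); rewrite -endoD !addr0.
Qed.

Lemma endoZ (X : fun_endo) a f w : X (fun x => a * f x) w = a * X f w.
Proof.
rewrite -[RHS]addr0 -(endo0 X w) -endo_linear; congr (X _ w).
by apply/funext => x; rewrite addr0.
Qed.

Definition endo_zero := @FunEndo (fun _ _ => 0)
  ltac:(by move=> * /=; rewrite mulr0 addr0).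
Definition endo_opp (X : fun_endo) := @FunEndo (fun f w => - X f w)
  ltac:(by move=> * /=; rewrite endo_linear opprD mulrN).
Definition endo_add (X Y : fun_endo) := @FunEndo (fun f w => X f w + Y f w)
  ltac:(by move=> * /=; rewrite !endo_linear mulrDr addrACA).
Definition endo_one := @FunEndo (fun f => f) ltac:(by []).
Definition endo_scale b (X : fun_endo) := @FunEndo (fun f w => b * X f w)
  ltac:(by move=> * /=; rewrite endo_linear mulrDr mulrCA).

Lemma endo_mul_linear (X Y : fun_endo) a f g w :
  X (Y (fun x => a * f x + g x)) w = a * X (Y f) w + X (Y g) w.
Proof.
by rewrite -endo_linear; congr (X _ w); apply/funext => x; rewrite endo_linear.
Qed.

Definition endo_mul (X Y : fun_endo) :=
  @FunEndo (fun f => X (Y f)) (endo_mul_linear X Y).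

Lemma endo_addA : associative endo_add.
Proof. by move=> X Y Z; apply: fun_endoP => f w; exact: addrA. Qed.
Lemma endo_addC : commutative endo_add.
Proof. by move=> X Y; apply: fun_endoP => f w; exact: addrC. Qed.
Lemma endo_add0r : left_id endo_zero endo_add.
Proof. by move=> X; apply: fun_endoP => f w; exact: add0r. Qed.
Lemma endo_addNr : left_inverse endo_zero endo_opp endo_add.
Proof. by move=> X; apply: fun_endoP => f w; exact: addNr. Qed.
Lemma endo_mulA : associative endo_mul.
Proof. by move=> X Y Z; apply: fun_endoP. Qed.
Lemma endo_mul1r : left_id endo_one endo_mul.
Proof. by move=> X; apply: fun_endoP. Qed.
Lemma endo_mulr1 : right_id endo_one endo_mul.
Proof. by move=> X; apply: fun_endoP. Qed.
Lemma endo_mulDl : left_distributive endo_mul endo_add.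
Proof. by move=> X Y Z; apply: fun_endoP. Qed.
Lemma endo_mulDr : right_distributive endo_mul endo_add.
Proof. by move=> X Y Z; apply: fun_endoP => f w; exact: endoD. Qed.
Lemma endo_oner_neq0 : endo_one != endo_zero.
Proof.
apply/eqP => /(congr1 (fun X : fun_endo => X (fun=> 1) 1%g)) /= /eqP.
by rewrite oner_eq0.
Qed.

HB.instance Definition _ := GRing.isNzRing.Build fun_endo endo_addA endo_addC
  endo_add0r endo_addNr endo_mulA endo_mul1r endo_mulr1 endo_mulDl endo_mulDr
  endo_oner_neq0.

Lemma endo_scaleA a b X : endo_scale a (endo_scale b X) = endo_scale (a * b) X.
Proof. by apply: fun_endoP => f w; exact: mulrA. Qed.
Lemma endo_scale1r : left_id 1 endo_scale.
Proof. by move=> X; apply: fun_endoP => f w; exact: mul1r. Qed.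
Lemma endo_scaleDr : right_distributive endo_scale +%R.
Proof. by move=> a X Y; apply: fun_endoP => f w; exact: mulrDr. Qed.
Lemma endo_scaleDl X : {morph endo_scale^~ X : a b / a + b}.
Proof. by move=> a b; apply: fun_endoP => f w; exact: mulrDl. Qed.

HB.instance Definition _ := GRing.Zmodule_isLmodule.Build R fun_endo
  endo_scaleA endo_scale1r endo_scaleDr endo_scaleDl.

Lemma endo_scaleAl a (X Y : fun_endo) : a *: (X * Y) = (a *: X) * Y.
Proof. exact: fun_endoP. Qed.

HB.instance Definition _ := GRing.Lmodule_isLalgebra.Build R fun_endo endo_scaleAl.

Lemma endo_scaleAr a (X Y : fun_endo) : a *: (X * Y) = X * (a *: Y).
Proof. by apply: fun_endoP => f w; exact: esym (endoZ X a (Y f) w). Qed.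

HB.instance Definition _ := GRing.Lalgebra_isAlgebra.Build R fun_endo endo_scaleAr.

End FunctionEndomorphisms.

(** * The regular representation and independence of the standard basis *)

Section RegularRepresentation.
Variables (W : groupType) (S : set W).
Hypothesis WS : coxeter_system S.
Implicit Types (s t : S) (e : seq S) (w x u : W) (f g : W -> laurent).
Local Open Scope ring_scope.

Let q : laurent := lauTV - lauT.

(* With f read as the functional H_w |-> f w on the Hecke algebra, these are
   f |-> f(_ H_s) and f |-> f(H_s _). *)
Definition rmul_fun s f w := f (w * \val s)%g + (rdescent w s)%:R * q * f w.
Definition lmul_fun s f w := f (\val s * w)%g + (ldescent s w)%:R * q * f w.

Lemma rmul_fun_linear s a f g w :
  rmul_fun s (fun x => a * f x + g x) w = a * rmul_fun s f w + rmul_fun s g w.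
Proof. by rewrite /rmul_fun; ring. Qed.

Definition rmul s := FunEndo (rmul_fun_linear s).

(** Unless tw = ws, neither multiplication affects the descent seen by the other. If tw = ws, both
    descents are equal and both flip, so the two sums still agree. *)
Lemma rmul_lmulC s t f w :
  rmul s (lmul_fun t f) w = lmul_fun t (rmul s f) w.
Proof.
rewrite /= /rmul_fun /lmul_fun ldescent_mulr// rdescent_mull// mulgA.
have [E|_] := eqVneq (\val t * w)%g (w * \val s)%g; last by rewrite !addbF; ring.
have -> : ldescent t w = rdescent w s by rewrite /ldescent E.
by rewrite E !addbT; case: rdescent => /=; ring.
Qed.

(** Exactly one of w and ws has s as a right descent. *)
Lemma rmul_sqr s : rmul s ^+ 2 = 1 + q *: rmul s.
Proof.
apply: fun_endoP => f w; rewrite expr2.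
change (rmul_fun s (rmul_fun s f) w = f w + q * rmul_fun s f w).
rewrite /rmul_fun rdescent_mulr// gen_mulgK//.
by case: rdescent => /=; ring.
Qed.

Lemma cox_length_mul_wprod w e :
  (cox_length S (w * wprod e)%g <= cox_length S w + size e)%N.
Proof.
have [e' [<- <-]] := reduced_exists WS w.
by rewrite -wprod_cat -size_cat cox_length_leq.
Qed.

(** Additivity of lengths makes every letter an ascent, so no term in [q] appears. *)
Lemma rmul_prod_up e f w : cox_length S (w * wprod e)%g = (cox_length S w + size e)%N ->
  (\prod_(s <- e) rmul s) f w = f (w * wprod e)%g.
Proof.
elim: e w => [|s e IHe] w; first by rewrite big_nil wprod_nil mulg1.
rewrite wprod_cons mulgA /= => lw.
have up : ~~ rdescent w s.
  have := cox_length_mul_wprod (w * \val s)%g e.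
  by rewrite lw addnS -addSn leq_add2r -leqNgt => /ltnW.
rewrite big_cons.
change (rmul_fun s ((\prod_(r <- e) rmul r) f) w = f (w * \val s * wprod e)%g).
rewrite /rmul_fun (negPf up) !mul0r addr0 IHe//.
by rewrite lw cox_length_rdescentN// addnS.
Qed.

Lemma rmul_prod_reduced e f w :
  reduced_expr e w -> (\prod_(s <- e) rmul s) f 1%g = f w.
Proof.
by move=> [<- le]; rewrite rmul_prod_up mul1g // -le cox_length1.
Qed.

Lemma rmul_prod_lmulC e t f w :
  (\prod_(s <- e) rmul s) (lmul_fun t f) w =
  lmul_fun t ((\prod_(s <- e) rmul s) f) w.
Proof.
elim: e w => [|s e IHe] w; first by rewrite big_nil.
rewrite big_cons.
change (rmul s ((\prod_(r <- e) rmul r) (lmul_fun t f)) w =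
  lmul_fun t (rmul s ((\prod_(r <- e) rmul r) f)) w).
by rewrite -rmul_lmulC; congr (rmul s _ w); apply/funext.
Qed.

(* The operators commute with the lmul_fun t, hence are determined by the values
   at 1 of the functions they produce. *)
Lemma rmul_prod_eq e e' w : reduced_expr e w -> reduced_expr e' w ->
  \prod_(s <- e) rmul s = \prod_(s <- e') rmul s.
Proof.
move=> re re'; apply: fun_endoP => f x.
have [c [<- lc]] := reduced_exists WS x.
have {lc} : reduced_expr c (wprod c) by [].
elim: c f => [|t c IHc] f rc.
  by rewrite wprod_nil (rmul_prod_reduced _ re) (rmul_prod_reduced _ re').
have [] := reduced_consK WS rc.
rewrite wprod_cons gen_mulK// ldescent_mull// => rc' up.
(* Since t is an ascent of the tail, the value at the longer element is a value of [lmul_fun t g] at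
   the tail; induction on [c] thus moves the evaluation point down to 1. *)
have lmulE g : g (\val t * wprod c)%g = lmul_fun t g (wprod c).
  by rewrite /lmul_fun (negPf up) !mul0r addr0.
by rewrite !lmulE -!rmul_prod_lmulC IHc.
Qed.

Lemma rmul_hecke_relations : hecke_relations rmul.
Proof.
split=> [s|s t _ m0]; first exact: rmul_sqr.
apply: rmul_prod_eq (braid_word_reduced WS s t) _.
by rewrite wprod_braid_word//; exact: braid_word_reduced.
Qed.

(** * Coordinates on the standard basis *)

Section StandardBasis.
Variables (H : algType laurent) (h : S -> H).
Hypothesis hH : hecke_algebra h.

Lemma prod_braid_equiv e e' : braid_equiv e e' ->
  \prod_(s <- e) h s = \prod_(s <- e') h s.
Proof.
move=> [B]; elim: B => // l r s t c st m0 _ <-.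
by rewrite !big_cat /=; congr (_ * (_ * _)); have [[_ ->]] := hH.
Qed.

(** A reduced word exists, so [xget] does not return its default, and by Matsumoto's theorem its
    choice does not affect the product. *)
Lemma hecke_stdE e w : reduced_expr e w -> hecke_std h w = \prod_(s <- e) h s.
Proof.
move=> re; apply: prod_braid_equiv; apply: (matsumoto WS _ re).
exact: (@xgetPex _ [::] [set e | reduced_expr e w] (ex_intro _ e re)).
Qed.

(** The coordinate at u lets x act on the indicator function of u and evaluates at 1. *)
Lemma hecke_std_coord : exists c : W -> {linear H -> laurent^o},
  forall u w, c u (hecke_std h w) = (w == u)%:R.
Proof.
have [_ /(_ _ _ rmul_hecke_relations)[phi phiE _]] := hH.
pose c u (x : H) : laurent^o := phi x (fun w => (w == u)%:R) 1%g.
have clin u : linear (c u) by move=> a x y; rewrite /c linearP.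
pose cL u : {linear H -> laurent^o} :=
  HB.pack (c u) (GRing.isLinear.Build _ _ _ _ _ (clin u)).
exists cL => u w; have [e re] := reduced_exists WS w.
rewrite (hecke_stdE re) /= /c rmorph_prod (eq_bigr rmul) => [|s _]; last exact: phiE.
exact: (rmul_prod_reduced _ re).
Qed.

End StandardBasis.
End RegularRepresentation.

(** * Transcendence of t - t^-1 *)

Section Transcendence.
Local Open Scope ring_scope.
Local Notation z := (lauT - lauTV).

(** Evaluation at t is the embedding of Z[t] in its fraction field, hence injective. *)
Lemma val_horner_lauT (p : {poly int}) :
  \val (map_poly (intr : int -> laurent) p).[lauT] = tofrac p.
Proof.
elim/poly_ind: p => [|p c IHp]; first by rewrite rmorph0 horner0 tofrac0 raddf0.
rewrite rmorphD rmorphM /= map_polyX map_polyC /= hornerMXaddC rmorphD rmorphM /=.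
rewrite IHp; congr (_ + _).
rewrite -[LHS]/(\val (c%:~R : laurent)) rmorph_int.
by rewrite -{2}[c]intz !rmorph_int.
Qed.

(* After multiplication by t^n, only the top term of p contributes to t^(2n). *)
Lemma lauT_transcendental (p : {poly int}) :
  (map_poly (intr : int -> laurent) p).[z] = 0 -> p = 0.
Proof.
move=> pz; apply/eqP; apply: contraT => p0; pose n := (size p).-1.
(* [Q] is t^n p(z) written in t: since zt = t^2 - 1, the term t^n z^i is (t^2 - 1)^i t^(n-i). *)
pose Q := \sum_(i < n.+1) p`_i *: (('X^2 - 1%:P) ^+ i * 'X^(n - i)) : {poly int}.
have zT : z * lauT = lauT ^+ 2 - 1 by rewrite mulrBl -expr2 [lauTV * _]mulrC lauT_lauTV.
have szp : (size (map_poly (intr : int -> laurent) p) <= n.+1)%N.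
  by rewrite /n prednK ?size_poly_gt0// size_poly.
have QE : (map_poly (intr : int -> laurent) Q).[lauT] = 0.
  transitivity ((map_poly (intr : int -> laurent) p).[z] * lauT ^+ n).
    rewrite (horner_coef_wide _ szp) mulr_suml rmorph_sum /= horner_sum.
    apply: eq_bigr => i _; rewrite map_polyZ hornerZ coef_map /= rmorphM.
    rewrite rmorphXn rmorphB /= !map_polyXn map_polyC /= hornerM horner_exp.
    rewrite hornerD hornerN !hornerXn hornerC -zT exprMn -!mulrA -exprD subnKC//.
    by rewrite -ltnS.
  by rewrite pz mul0r.
have {QE} : Q = 0.
  apply/eqP; rewrite -tofrac_eq0 -val_horner_lauT QE.
  by rewrite raddf0.
move/(congr1 (fun r : {poly int} => r`_(n.*2))).
rewrite coef0 coef_sum big_ord_recr /= big1 ?add0r; last first.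
  (* For i < n the summand has degree at most 2i + (n - i) = n + i < 2n. *)
  move=> i _; rewrite coefZ [X in _ * X]nth_default ?mulr0//.
  have mon : ('X^2 - 1%:P) ^+ i \is @monic int by rewrite monic_exp ?monicXnsubC.
  have := size_exp ('X^2 - 1%:P : {poly int}) i.
  rewrite size_XnsubC// size_mulXn ?monic_neq0//.
  have := ltn_ord i; move: (size _) => k; lia.
rewrite subnn expr0 mulr1 coefZ.
have mon : ('X^2 - 1%:P) ^+ n \is @monic int by rewrite monic_exp ?monicXnsubC.
have -> : (('X^2 - 1%:P) ^+ n : {poly int})`_n.*2 = 1.
  by have := monicP mon; rewrite lead_coefE size_exp size_XnsubC //= mul2n.
by rewrite mulr1 => /eqP; rewrite -lead_coefE lead_coef_eq0 (negPf p0).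
Qed.

(** Coefficients pass to the integers, where the difference can be formed and transcendence
    applies. *)
Lemma natpoly_eval_inj (p p' : {poly nat}) :
  (map_poly (fun n : nat => n%:R : laurent) p).[z] =
  (map_poly (fun n : nat => n%:R : laurent) p').[z] -> p = p'.
Proof.
pose toZ := map_poly (fun n : nat => n%:R : int).
have toZE r : map_poly (fun n : nat => n%:R : laurent) r =
    map_poly (intr : int -> laurent) (toZ r).
  by apply/polyP => i; rewrite !coef_map_id0 //= natz.
rewrite !toZE => /eqP; rewrite -subr_eq0 -hornerN -hornerD -rmorphB => /eqP.
move=> /lauT_transcendental /eqP; rewrite subr_eq0 => /eqP/polyP E.
apply/polyP => i; have := E i; rewrite !coef_map_id0 //= !natz.
by case.
Qed.

End Transcendence.

(** * Light leaves *)

Section LightLeaves.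
Variables (W : groupType) (S : set W).
Hypothesis WS : coxeter_system S.
Implicit Types (s t : S) (b e w : seq S) (u v : W).
Local Open Scope ring_scope.
Local Notation z := (lauT - lauTV).

HB.instance Definition _ := gen_eqMixin (diagram S).

Lemma reduced_wprod e u : reduced_expr e u -> reduced_expr e (wprod e).
Proof. by move=> [<- le]; split. Qed.

(** Reducedness of the top word is kept along the tree, so the braid moves at unary nodes always
    exist. *)
Lemma lltree_inhabited w b e (D : sgraph b e) :
  reduced_expr e (wprod e) -> inhabited (lltree D w).
Proof.
elim: w b e D => [|s w IHw] b e D re; first exact/inhabits/LLleaf.
have [ds|us] := boolP (rdescent (wprod e) s).
  have [e'' re'' [B]] := rdescent_braid_equiv WS re ds.
  have [|T] := IHw _ _ (add_arc (stack_moves B D)).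
    by rewrite cats0; exact: reduced_wprod re''.
  by constructor; apply: LLdown ds T.
have up : (cox_length S (wprod e) < cox_length S (wprod e * \val s)%g)%N.
  by rewrite cox_length_rdescentN.
have [|T1] := IHw _ _ (add_strand D s).
  exact: reduced_wprod (reduced_rcons WS re us).
have [|T2] := IHw _ _ (add_dot D s); first by rewrite cats0.
by constructor; apply: LLup up T1 T2.
Qed.

Lemma sdeg_stack_moves b e e' (B : braid_moves e e') (D : sgraph b e) :
  sdeg (stack_moves B D) = sdeg D.
Proof. by elim: B D => //= l r s t c st m0 B IHB D; rewrite IHB /= !addn0. Qed.

Lemma light_leaves_reduced b e (D : sgraph b e) w (T : lltree D w) :
  reduced_expr e (wprod e) ->
  {in light_leaves T, forall l, reduced_expr (dtop l) (wprod (dtop l))}.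
Proof.
elim: T => {b e D w} [b e D|b e D s w up T1 IH1 T2 IH2|b e D s w e'' B dn T IH] re.
- by move=> l; rewrite inE => /eqP->.
- have us : ~~ rdescent (wprod e) s by rewrite /rdescent -leqNgt ltnW.
  move=> l; rewrite mem_cat => /orP[/IH1|/IH2]; apply; last by rewrite cats0.
  exact: reduced_wprod (reduced_rcons WS re us).
- apply: IH; rewrite cats0; have := reduced_braid_equiv WS (inhabits B) re.
  rewrite (wprod_braid_equiv WS (inhabits B)) => -[_].
  rewrite size_cat addn1 wprod_cat wprod_seq1 => sz; split=> //.
  (* Dropping the last letter lowers the length by at most one, so what remains of a reduced word is
     reduced. *)
  apply/eqP; rewrite eqn_leq cox_length_leq andbT -ltnS sz.
  by have := cox_length_mul_wprod WS (wprod e'') [:: s]; rewrite wprod_seq1 addn1.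
Qed.

(** * Expansion of the inverse along the tree *)

Section Hecke.
Variables (H : algType laurent) (h : S -> H).
Hypothesis hH : hecke_algebra h.

(** The coefficient t^-1 - t in the quadratic relation is -z. *)
Lemma hecke_gen_inv_mull s : (h s + z%:A) * h s = 1.
Proof.
have [[/(_ s) sqr _] _] := hH; rewrite mulrDl -expr2 sqr -scalerAl mul1r.
by rewrite -addrA -scalerDl addrC subrKA subrr scale0r add0r.
Qed.

Lemma hecke_gen_inv_mulr s : h s * (h s + z%:A) = 1.
Proof.
by rewrite -[RHS](hecke_gen_inv_mull s) mulrDl mulrDr -scalerAl -scalerAr mul1r mulr1.
Qed.

Lemma hecke_std_up u s : ~~ rdescent u s ->
  hecke_std h u * h s = hecke_std h (u * \val s)%g.
Proof.
move=> us; have [e re] := reduced_exists WS u.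
rewrite (hecke_stdE WS hH re) (hecke_stdE WS hH (reduced_rcons WS re us)).
by rewrite big_cat big_seq1.
Qed.

Lemma hecke_std_down u s : rdescent u s ->
  hecke_std h u * (h s + z%:A) = hecke_std h (u * \val s)%g.
Proof.
move=> ds; have us : ~~ rdescent (u * \val s)%g s by rewrite rdescent_mulr ?negbK.
have := hecke_std_up us; rewrite gen_mulgK// => <-.
by rewrite -mulrA hecke_gen_inv_mulr mulr1.
Qed.

(** Induction on the tree: a binary node distributes H_u (H_s + z), the dot child taking the factor
    z; at a unary node the braid moves change neither the degree nor the product of the top word. *)
Lemma light_leaves_sum b e (D : sgraph b e) w (T : lltree D w) :
  z ^+ sdeg D *: (hecke_std h (wprod e) * \prod_(s <- w) (h s + z%:A)) =
  \sum_(l <- light_leaves T) z ^+ ddeg l *: hecke_std h (wprod (dtop l)).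
Proof.
elim: T => {b e D w} [b e D|b e D s w up T1 IH1 T2 IH2|b e D s w e'' B dn T IH] /=.
- by rewrite big_nil mulr1 big_seq1.
- have us : ~~ rdescent (wprod e) s by rewrite /rdescent -leqNgt ltnW.
  rewrite big_cons big_cat /= -IH1 -IH2 /= addn0 addn1 cats0 wprod_cat wprod_seq1.
  rewrite -(hecke_std_up us) exprSr -scalerA -scalerDr; congr (_ *: _).
  by rewrite scalerAl -mulrDl mulrA mulrDr -scalerAr mulr1.
- rewrite big_cons -IH /= sdeg_stack_moves !addn0 cats0 mulrA hecke_std_down//.
  by rewrite (wprod_braid_equiv WS (inhabits B)) wprod_cat wprod_seq1 gen_mulgK.
Qed.

Lemma fsum_hecke_std (r : seq W) (R : W -> laurent) :
  uniq r -> (forall u, u \notin r -> R u = 0) ->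
  \sum_(u \in [set: W]) R u *: hecke_std h u = \sum_(u <- r) R u *: hecke_std h u.
Proof.
move=> ur R0; rewrite [RHS]fsbig_seq//; symmetry.
apply: fsbig_widen => // u [_ /negP ru] /=.
by rewrite R0 ?scale0r.
Qed.

(** Finite support keeps the sums away from their default value, so the coordinate functionals
    recover the coefficients. *)
Lemma hecke_std_independent (R R' : W -> laurent) :
  finite_set [set u | R u != 0] -> finite_set [set u | R' u != 0] ->
  \sum_(u \in [set: W]) R u *: hecke_std h u =
  \sum_(u \in [set: W]) R' u *: hecke_std h u -> R = R'.
Proof.
have [c cE] := hecke_std_coord WS hH.
have coordE (Q : W -> laurent) u : finite_set [set u | Q u != 0] ->
    c u (\sum_(u \in [set: W]) Q u *: hecke_std h u) = Q u.
  move=> /finite_seqP[r0 r0E].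
  have Q0 v : v \notin undup r0 -> Q v = 0.
    rewrite mem_undup; apply: contraNeq => Qv.
    by have : [set u | Q u != 0] v by []; rewrite r0E.
  rewrite (fsum_hecke_std (undup_uniq r0))// linear_sum /=.
  under eq_bigr do rewrite linearZ /= cE.
  have [ur|ur] := boolP (u \in undup r0).
    rewrite (bigD1_seq u) ?undup_uniq//= eqxx big1 ?addr0 => [|v /negPf->].
      exact: mulr1.
    exact: mulr0.
  rewrite Q0// big_seq big1// => v vr.
  suff /negPf-> : v != u by exact: mulr0.
  by apply: contraNneq ur => <-.
by move=> fR fR' E; apply/funext => u; rewrite -(coordE R)// E coordE.
Qed.

(** H_(v^-1) is the product of the H_s along the reversed word, so each product with it cancels from
    the middle outwards. *)
Lemma hecke_std_inv vw v : reduced_expr vw v ->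
  \prod_(s <- vw) (h s + z%:A) * hecke_std h v^-1%g = 1 /\
  hecke_std h v^-1%g * \prod_(s <- vw) (h s + z%:A) = 1.
Proof.
move=> [<- le]; have rv : reduced_expr (rev vw) (wprod vw)^-1%g.
  by split; rewrite ?wprod_rev// size_rev le cox_length_inv.
rewrite (hecke_stdE WS hH rv); elim: {le rv} vw => [|s e [IH1 IH2]].
  by rewrite !big_nil mulr1.
rewrite rev_cons -cats1 big_cat big_seq1 big_cons /=; split.
  by rewrite mulrA -[_ * _ * \prod_(_ <- rev _) _]mulrA IH1 mulr1 hecke_gen_inv_mull.
by rewrite mulrA -[_ * h s * _]mulrA hecke_gen_inv_mulr mulr1.
Qed.

Variables (vw : seq S) (v : W).
Hypothesis vwv : reduced_expr vw v.

Definition diag_R (T : light_leaves_tree vw) u : laurent :=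
  (map_poly (fun n : nat => n%:R : laurent) (diag_Rtilde u T)).[z].

Lemma diag_RE (T : light_leaves_tree vw) u :
  diag_R T u = \sum_(l <- light_leaves T | wprod (dtop l) == u) z ^+ ddeg l.
Proof.
rewrite /diag_R /diag_Rtilde rmorph_sum /= horner_sum.
rewrite big_seq_cond [RHS]big_seq_cond; apply: eq_big => [l|l _]; last first.
  by rewrite map_polyXn hornerXn.
have [lT|//] := boolP (l \in light_leaves T); rewrite /=.
have re : reduced_expr (dtop l) (wprod (dtop l)).
  by apply: light_leaves_reduced lT; rewrite wprod_nil; exact: reduced_nil.
by apply/asboolP/eqP => [[]//|<-].
Qed.

Lemma diag_R_family (T : light_leaves_tree vw) : R_family h v (diag_R T).
Proof.
set r := undup [seq wprod (dtop l) | l <- light_leaves T].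
have lr l : l \in light_leaves T -> wprod (dtop l) \in r.
  by move=> lT; rewrite mem_undup; apply: map_f.
have R0 u : u \notin r -> diag_R T u = 0.
  move=> ur; rewrite diag_RE big_seq_cond big1// => l /andP[/lr lur /eqP lu].
  by rewrite -lu lur in ur.
rewrite /R_family; have -> : \sum_(u \in [set: W]) diag_R T u *: hecke_std h u =
    \prod_(s <- vw) (h s + z%:A).
  rewrite (fsum_hecke_std (undup_uniq _) R0).
  have := light_leaves_sum T; rewrite /= expr0 scale1r wprod_nil.
  rewrite (hecke_stdE WS hH (reduced_nil S)) big_nil mul1r => ->.
  under eq_bigr do rewrite diag_RE scaler_suml.
  (* After the exchange, each leaf contributes only at the product of its own top word. *)
  rewrite (exchange_big_dep predT) //= [RHS]big_seq big_seq.
  apply: eq_bigr => l /lr lr'; rewrite big_mkcond (bigD1_seq (wprod (dtop l)))//=.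
    by rewrite eqxx big1 ?addr0// => u; rewrite eq_sym => /negPf->.
  exact: undup_uniq.
have [inv1 inv2] := hecke_std_inv vwv; split=> //.
apply: (sub_finite_set (B := [set` r])); last exact: finite_seq.
by move=> u /=; apply: contraNT => /R0 ->.
Qed.

(** Two-sided inverses are unique, and independence turns equality of sums into equality of
    coefficient families. *)
Lemma RpolyE (T : light_leaves_tree vw) u : Rpoly h u v = diag_R T u.
Proof.
rewrite /Rpoly; congr (_ u); apply: xget_unique; first exact: diag_R_family.
move=> R [fR inv1 inv2]; have [fR' inv1' inv2'] := diag_R_family T.
apply: hecke_std_independent => //.
by rewrite -[LHS]mulr1 -inv2' mulrA inv1 mul1r.
Qed.

End Hecke.
End LightLeaves.

Theorem theorem3p1 (W : groupType) (S : set W) (WS : coxeter_system S)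
    (H : algType laurent) (h : S -> H) (hH : hecke_algebra h)
    (v : W) (vw : seq S) (vwv : reduced_expr vw v) :
  [/\ inhabited (light_leaves_tree vw),
      (forall (T : light_leaves_tree vw) (u : W),
         diag_Rtilde u T = Rtilde h u v)
    & (forall (vw' : seq S), reduced_expr vw' v ->
       forall (T : light_leaves_tree vw) (T' : light_leaves_tree vw') (u : W),
         diag_Rtilde u T = diag_Rtilde u T')].
Proof.
have diagE (w : seq S) (wv : reduced_expr w v) (T : light_leaves_tree w) u :
    diag_Rtilde u T = Rtilde h u v.
  (* The diagrammatic polynomial is an admissible value for [Rtilde], and transcendence of z makes
     it the only one. *)
  apply/esym/xget_unique; first exact: RpolyE.
  by move=> p /= pE; apply: natpoly_eval_inj; rewrite -pE (RpolyE WS hH wv T).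
split=> [|T u|vw' vwv' T T' u]; last 2 first.
- exact: diagE.
- by rewrite !diagE.
by apply: lltree_inhabited => //; rewrite wprod_nil; exact: reduced_nil.
Qed.
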